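(* Let $\ell\ge 1$ be an integer, let $\mathcal{C}=\{c_\sigma\}_{\sigma\in\operatorname{Perm}(4\ell)}$ be a collection of real constants, and let $(V_1,\varepsilon_1)$ and $(V_2,\varepsilon_2)$ be inner product spaces of signatures $(p_1,q_1)$ and $(p_2,q_2)$ with the same dimension $m=p_1+q_1=p_2+q_2$. Then $$P_{2\ell,\mathcal{C},\varepsilon_1}(A_1)=0\ \ \forall\, A_1\in\mathfrak{A}(V_1)\quad\Longleftrightarrow\quad P_{2\ell,\mathcal{C},\varepsilon_2}(A_2)=0\ \ \forall\, A_2\in\mathfrak{A}(V_2).$$
   Context: An inner product space $(V,\varepsilon)$ of signature $(p,q)$ is a real vector space $V$ of dimension $m=p+q$ with a non-degenerate symmetric bilinear form $\varepsilon$ having $p$ negative (timelike) and $q$ positive (spacelike) directions. $\mathfrak{A}(V)\subset\otimes^4(V^* )$ is the space of algebraic curvature tensors: those $A\in\otimes^4(V^* )$ such that for all $x,y,z,w\in V$ $$A(x,y,z,w)=-A(y,x,z,w)=A(z,w,x,y),\qquad A(x,y,z,w)+A(y,z,x,w)+A(z,x,y,w)=0.$$ $\operatorname{Perm}(4\ell)$ is the group of permutations of $\{1,\dots,4\ell\}$; write $\sigma_i=\sigma(i)$. Let $\{e_i\}$ be a basis of $V$, $\varepsilon_{ij}=\varepsilon(e_i,e_j)$, $\varepsilon^{ij}$ the inverse matrix, and $A_{ijkl}=A(e_i,e_j,e_k,e_l)$. Summing over repeated indices, set $$P_{2\ell,\sigma,\varepsilon}(A)=\varepsilon^{i_1i_2}\cdots\varepsilon^{i_{4\ell-1}i_{4\ell}}\,A_{i_{\sigma_1}i_{\sigma_2}i_{\sigma_3}i_{\sigma_4}}\cdots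 A_{i_{\sigma_{4\ell-3}}i_{\sigma_{4\ell-2}}i_{\sigma_{4\ell-1}}i_{\sigma_{4\ell}}},$$ which does not depend on the choice of basis, and $$P_{2\ell,\mathcal{C},\varepsilon}=\sum_{\sigma\in\operatorname{Perm}(4\ell)}c_\sigma P_{2\ell,\sigma,\varepsilon}.$$ *)

(* Defs.v *)
From HB Require Import structures.
From mathcomp Require Import all_boot all_order all_algebra all_fingroup.
From mathcomp Require Import reals.

Set Implicit Arguments.
Unset Strict Implicit.
Unset Printing Implicit Defensive.

Import Order.TTheory GRing.Theory Num.Theory.
Local Open Scope ring_scope.

Section InnerProductSpace.
Variables (R : realType) (V : vectType R).

(* [p] counts the negative (timelike) and [q] the positive (spacelike)
   directions of an orthonormal basis. *)
Definition has_signature (eps : {symmetric V}) (p q : nat) : Prop :=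
  exists b : (p + q).-tuple V, basis_of {:V} b /\
    forall i j : 'I_(p + q),
      eps (tnth b i) (tnth b j) =
        if i == j then (if (i < p)%N then -1 else 1) else 0.

Definition inner_product_space (eps : {symmetric V}) (p q : nat) : Prop :=
  [/\ \dim {:V} = (p + q)%N, nondegenerate eps & has_signature eps p q].

Definition multilinear4 (A : V -> V -> V -> V -> R) : Prop :=
  [/\ forall y z w, scalar (fun x => A x y z w),
      forall x z w, scalar (fun y => A x y z w),
      forall x y w, scalar (fun z => A x y z w) &
      forall x y z, scalar (fun w => A x y z w)].

Definition curvature_tensor (A : V -> V -> V -> V -> R) : Prop :=
  [/\ multilinear4 A,
      forall x y z w, A x y z w = - A y x z w,
      forall x y z w, A x y z w = A z w x y &
      forall x y z w, A x y z w + A y z x w + A z x y w = 0].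

End InnerProductSpace.

(* The 4l index positions are numbered from 0, so that 1, ..., 4l becomes
   0, ..., 4l - 1: the k-th factor of eps^-1 occupies the positions 2k, 2k + 1,
   and the k-th factor of A the positions 4k, ..., 4k + 3. *)
Fact metric_slot_subproof (l : nat) (k : 'I_(2 * l)) (r : 'I_2) :
  (2 * k + r < 4 * l)%N.
Proof.
apply: (@leq_trans (2 * k.+1)); first by rewrite mulnS addnC ltn_add2r.
by rewrite -[4%N]/(2 * 2)%N -mulnA leq_pmul2l.
Qed.

Definition metric_slot (l : nat) (k : 'I_(2 * l)) (r : 'I_2) : 'I_(4 * l) :=
  Ordinal (metric_slot_subproof k r).

Fact tensor_slot_subproof (l : nat) (k : 'I_l) (r : 'I_4) :
  (4 * k + r < 4 * l)%N.
Proof.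
apply: (@leq_trans (4 * k.+1)); first by rewrite mulnS addnC ltn_add2r.
by rewrite leq_pmul2l.
Qed.

Definition tensor_slot (l : nat) (k : 'I_l) (r : 'I_4) : 'I_(4 * l) :=
  Ordinal (tensor_slot_subproof k r).

Section Invariants.
Variables (R : realType) (V : vectType R) (m l : nat).
Variables (eps : {symmetric V}) (e : m.-tuple V).

Definition gram : 'M[R]_m := \matrix_(i, j) eps (tnth e i) (tnth e j).

(* The numerals 0, 1, 2, 3 below are elements of 'I_2 or of 'I_4. *)
Definition Pinv_perm (s : 'S_(4 * l)) (A : V -> V -> V -> V -> R) : R :=
  \sum_(i : {ffun 'I_(4 * l) -> 'I_m})
    (\prod_(k < 2 * l)
       invmx gram (i (metric_slot k 0)) (i (metric_slot k 1))) *
    \prod_(k < l)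
       A (tnth e (i (s (tensor_slot k 0)))) (tnth e (i (s (tensor_slot k 1))))
         (tnth e (i (s (tensor_slot k 2)))) (tnth e (i (s (tensor_slot k 3)))).

Definition Pinv (c : 'S_(4 * l) -> R) (A : V -> V -> V -> V -> R) : R :=
  \sum_(s : 'S_(4 * l)) c s * Pinv_perm s A.

End Invariants.

(* Main.v *)
Require Import Defs.
From mathcomp Require Import all_boot all_order all_algebra all_fingroup.
From mathcomp Require Import reals.

Set Implicit Arguments.
Unset Strict Implicit.
Unset Printing Implicit Defensive.

Import Order.TTheory GRing.Theory Num.Theory.
Local Open Scope ring_scope.

(** The invariant depends on the metric only through the matrix [G] of its
inverse in the chosen basis, and it is polynomial in the entries of [G]. Say
that the invariant vanishes on [G] when it is zero for every curvature tensor
evaluated on every family of [m] vectors of every space; since any such family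
is the linear image of a basis, and a curvature tensor pulls back along a linear
map to a curvature tensor, it is enough to test one basis of one space
([Pinv_vanishes]). This makes the condition independent of the space.

Multilinearity moves a matrix [T] from the metric to the vectors: contracting
with [T^T *m G *m T] is contracting with [G] after replacing each vector [v a]
by the combination [\sum_b T a b *: v b] ([contraction_congruence]). So the
vanishing set is stable under congruence, and one may replace both inverse
metrics by diagonal matrices of signs [D] and [D'] ([invmx_gram_signs]).

On the line [x |-> (1 - x) D + x D'], the entries keep the signs of [D] when
[0 < x < 1/2], so these matrices are congruent to [D] through a real diagonal
matrix of square roots and the invariant vanishes on them. For a fixed tensor
and fixed vectors its value is a polynomial in [x] with infinitely many roots;
it is zero, in particular at [x = 1], which is [D']
([invariant_vanishes_signs]). *)

(** * Distributing products over the index slots *)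

Lemma sum_ffun2 (J : finType) (S : nmodType) (F : {ffun 'I_2 -> J} -> S) :
  \sum_g F g = \sum_a \sum_b F [ffun r : 'I_2 => nth a [:: a; b] r].
Proof.
rewrite pair_big /=.
rewrite (reindex (fun p : J * J => [ffun r : 'I_2 => nth p.1 [:: p.1; p.2] r])) //=.
exists (fun g : {ffun 'I_2 -> J} => (g 0, g 1)) => [[a b] _|g _].
  by rewrite !ffunE.
by apply/ffunP => -[[|[|//]] lt_r2]; rewrite ffunE; congr (g _); apply: val_inj.
Qed.

Lemma sum_ffun4 (J : finType) (S : nmodType) (F : {ffun 'I_4 -> J} -> S) :
  \sum_g F g = \sum_a \sum_b \sum_c \sum_d
                 F [ffun r : 'I_4 => nth a [:: a; b; c; d] r].
Proof.
under [RHS]eq_bigr do under eq_bigr do rewrite pair_big /=.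
under [RHS]eq_bigr do rewrite pair_big /=.
rewrite pair_big /=.
rewrite (reindex (fun p : J * (J * (J * J)) => [ffun r : 'I_4 =>
  nth p.1 [:: p.1; p.2.1; p.2.2.1; p.2.2.2] r])) //=.
exists (fun g : {ffun 'I_4 -> J} => (g 0, (g 1, (g 2, g 3)))) =>
    [[a [b [c d]]] _|g _].
  by rewrite !ffunE.
apply/ffunP => -[[|[|[|[|//]]]] lt_r4]; rewrite ffunE /=; congr (g _);
  exact: val_inj.
Qed.

(** A multi-index on the [4 l] positions is cut into the index blocks of the
individual factors by a bijection [h : K * L -> N], where [h k r] is the
[r]-th position of the [k]-th factor. *)

Section Slots.
Variables (K L N J : finType) (S : comNzRingType) (h : K -> L -> N).
Hypothesis h_bij : bijective (fun p => h p.1 p.2).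

Lemma prod_slots (F : N -> S) : \prod_n F n = \prod_k \prod_r F (h k r).
Proof. by rewrite pair_big /=; apply: reindex; apply: onW_bij. Qed.

(** Choosing the indices of each factor separately is choosing one global
multi-index; this is what lets a product of local expansions be written as a
single sum over multi-indices. *)
Lemma prod_sum_slots (F : K -> {ffun L -> J} -> S) :
  \prod_k \sum_g F k g =
  \sum_(i : {ffun N -> J}) \prod_k F k [ffun r => i (h k r)].
Proof.
rewrite bigA_distr_bigA /=; case: h_bij => h' hK h'K.
rewrite (reindex (fun i : {ffun N -> J} => [ffun k => [ffun r => i (h k r)]])).
  by apply: eq_bigr => i _; apply: eq_bigr => k _; rewrite ffunE.
exists (fun f : {ffun K -> {ffun L -> J}} => [ffun n => f (h' n).1 (h' n).2]).
  by move=> i _; apply/ffunP => n; rewrite !ffunE h'K.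
move=> f _; apply/ffunP => k; apply/ffunP => r; rewrite !ffunE.
by rewrite (hK (k, r)).
Qed.

End Slots.

Lemma metric_slot_bij l :
  bijective (fun p : 'I_(2 * l) * 'I_2 => metric_slot p.1 p.2).
Proof.
apply: inj_card_bij => [[k r] [k' r'] /= /(congr1 val) /= eq_kr|]; last first.
  by rewrite card_prod !card_ord mulnAC.
move: (congr1 (divn^~ 2%N) eq_kr) (congr1 (modn^~ 2%N) eq_kr).
rewrite [(2 * k)%N]mulnC [(2 * k')%N]mulnC !divnMDl // !modnMDl.
rewrite !(divn_small (ltn_ord _)) !addn0  !(modn_small (ltn_ord _)).
by move=> /ord_inj-> /ord_inj->.
Qed.

Lemma tensor_slot_bij l :
  bijective (fun p : 'I_l * 'I_4 => tensor_slot p.1 p.2).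
Proof.
apply: inj_card_bij => [[k r] [k' r'] /= /(congr1 val) /= eq_kr|]; last first.
  by rewrite card_prod !card_ord mulnC.
move: (congr1 (divn^~ 4%N) eq_kr) (congr1 (modn^~ 4%N) eq_kr).
rewrite [(4 * k)%N]mulnC [(4 * k')%N]mulnC !divnMDl // !modnMDl.
rewrite !(divn_small (ltn_ord _)) !addn0  !(modn_small (ltn_ord _)).
by move=> /ord_inj-> /ord_inj->.
Qed.

(** * The invariant as a function of the inverse metric *)

Section Contraction.
Variables (R : realType) (m l : nat).
Implicit Types (V : vectType R) (G T : 'M[R]_m).

(** The invariant with the inverse Gram matrix replaced by an arbitrary [G] and
the basis by an arbitrary family [v], so that both can be varied
independently. *)
Definition contraction V G (v : 'I_m -> V) (s : 'S_(4 * l))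
    (A : V -> V -> V -> V -> R) : R :=
  \sum_(i : {ffun 'I_(4 * l) -> 'I_m})
    (\prod_(k < 2 * l) G (i (metric_slot k 0)) (i (metric_slot k 1))) *
    \prod_(k < l)
       A (v (i (s (tensor_slot k 0)))) (v (i (s (tensor_slot k 1))))
         (v (i (s (tensor_slot k 2)))) (v (i (s (tensor_slot k 3)))).

Lemma scalar_sum V (f : V -> R) (t : 'I_m -> R) (v : 'I_m -> V) :
  scalar f -> f (\sum_i t i *: v i) = \sum_i t i * f (v i).
Proof.
move=> f_lin; have f0 : f 0 = 0.
  by have := f_lin (-1) 0 0; rewrite scaler0 addr0 mulN1r addNr.
by elim/big_rec2: _ => // i y x _ <-; rewrite f_lin.
Qed.

Lemma multilinear4_sum V (A : V -> V -> V -> V -> R) (v : 'I_m -> V) T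
    (j : 'I_4 -> 'I_m) :
  let w a := \sum_b T a b *: v b in multilinear4 A ->
  A (w (j 0)) (w (j 1)) (w (j 2)) (w (j 3)) =
  \sum_(g : {ffun 'I_4 -> 'I_m})
    (\prod_r T (j r) (g r)) * A (v (g 0)) (v (g 1)) (v (g 2)) (v (g 3)).
Proof.
move=> w [A1 A2 A3 A4]; rewrite sum_ffun4.
rewrite (scalar_sum _ _ (A1 _ _ _)); apply: eq_bigr => a _.
rewrite (scalar_sum _ _ (A2 _ _ _)) mulr_sumr; apply: eq_bigr => b _.
rewrite (scalar_sum _ _ (A3 _ _ _)) !mulr_sumr; apply: eq_bigr => c _.
rewrite (scalar_sum _ _ (A4 _ _ _)) !mulr_sumr; apply: eq_bigr => d _.
rewrite !big_ord_recl big_ord0 mulr1 !ffunE /= !mulrA.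
by congr (T (j _) _ * T (j _) _ * T (j _) _ * T (j _) _ * _); apply: val_inj.
Qed.

Lemma congruence_sum G T (i : 'I_2 -> 'I_m) :
  (T^T *m G *m T) (i 0) (i 1) =
  \sum_(g : {ffun 'I_2 -> 'I_m}) G (g 0) (g 1) * \prod_r T (g r) (i r).
Proof.
rewrite sum_ffun2 exchange_big mxE; apply: eq_bigr => b _ /=.
rewrite mxE mulr_suml; apply: eq_bigr => a _.
rewrite mxE !big_ord_recl big_ord0 mulr1 !ffunE /= [T a _ * _]mulrC -!mulrA.
by congr (_ * (T _ (i _) * T _ (i _))); apply: val_inj.
Qed.

(** Expanding the [2 l] entries of [T^T *m G *m T] produces one factor
[T (j n) (i n)] for each of the [4 l] positions [n], and so does expanding the
[l] factors [A] by multilinearity. Both sides are therefore the same double sum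
over multi-indices [i] and [j]; the permutation [s] only changes which position
belongs to which slot of [A]. *)
Lemma contraction_congruence V G T (v : 'I_m -> V) s A : multilinear4 A ->
  contraction (T^T *m G *m T) v s A =
  contraction G (fun a => \sum_b T a b *: v b) s A.
Proof.
move=> A_lin; rewrite /contraction.
pose sts (k : 'I_l) (r : 'I_4) := s (tensor_slot k r).
have sts_bij : bijective (fun p => sts p.1 p.2).
  apply: bij_comp (tensor_slot_bij l).
  by exists (s^-1)%g; [exact: permK | exact: permKV].
transitivity (\sum_(i : {ffun 'I_(4 * l) -> 'I_m})
    \sum_(j : {ffun 'I_(4 * l) -> 'I_m})
    (\prod_(k < 2 * l) G (j (metric_slot k 0)) (j (metric_slot k 1))) *
    (\prod_n T (j n) (i n)) *
    \prod_(k < l)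
       A (v (i (s (tensor_slot k 0)))) (v (i (s (tensor_slot k 1))))
         (v (i (s (tensor_slot k 2)))) (v (i (s (tensor_slot k 3))))).
  apply: eq_bigr => i _; rewrite -mulr_suml; congr (_ * _).
  under eq_bigr do rewrite (congruence_sum G T (fun r => i (metric_slot _ r))).
  rewrite (prod_sum_slots (metric_slot_bij l)); apply: eq_bigr => j _.
  rewrite big_split /= (prod_slots (metric_slot_bij l)); congr (_ * _).
    by apply: eq_bigr => k _; rewrite !ffunE.
  by apply: eq_bigr => k _; apply: eq_bigr => r _; rewrite !ffunE.
rewrite exchange_big /=; apply: eq_bigr => j _.
under eq_bigr do rewrite -mulrA.
rewrite -mulr_sumr; congr (_ * _); apply/esym.
under eq_bigr do
  rewrite (multilinear4_sum v T (fun r => j (s (tensor_slot _ r))) A_lin).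
rewrite (prod_sum_slots (h := sts) sts_bij); apply: eq_bigr => i _.
rewrite big_split /= (prod_slots (h := sts) sts_bij); congr (_ * _).
  by apply: eq_bigr => k _; apply: eq_bigr => r _; rewrite !ffunE.
by apply: eq_bigr => k _; rewrite !ffunE.
Qed.

Variable c : 'S_(4 * l) -> R.

(** Quantifying over all spaces frees the condition from the space it is tested
on; quantifying over all families makes it stable under replacing [v] by linear
combinations of its members, also when these no longer span. *)
Definition invariant_vanishes G : Prop :=
  forall V (v : 'I_m -> V) A, curvature_tensor A ->
    \sum_s c s * contraction G v s A = 0.

Lemma invariant_vanishes_congruence G T :
  invariant_vanishes G -> invariant_vanishes (T^T *m G *m T).
Proof.
move=> G0 V v A A_curv.
rewrite -[RHS](G0 V (fun a => \sum_b T a b *: v b) A A_curv).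
by apply: eq_bigr => s _; case: A_curv => A_lin _ _ _;
  rewrite contraction_congruence.
Qed.

Lemma curvature_tensor_pullback V (W : vectType R) (f : V -> W) A :
  linear f -> curvature_tensor A ->
  curvature_tensor (fun x y z w => A (f x) (f y) (f z) (f w)).
Proof.
move=> f_lin [[A1 A2 A3 A4] Asym Apair Abianchi]; split=> //.
by split=> x y z a u u'; rewrite f_lin ?A1 ?A2 ?A3 ?A4.
Qed.

(** Sending the basis [e] to an arbitrary family [v] defines a linear map [f];
evaluating [A] on [v] is evaluating the pullback of [A] along [f] on [e]. *)
Lemma Pinv_vanishes V (eps : {symmetric V}) (e : m.-tuple V) :
  basis_of {:V} e ->
  (forall A, curvature_tensor A -> Pinv eps e c A = 0) <->
  invariant_vanishes (invmx (gram eps e)).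
Proof.
move=> e_basis; split=> [P0 W v A A_curv | G0 A]; last exact: G0.
pose f x := \sum_i coord e i x *: v i.
have f_lin : linear f.
  move=> a x y; rewrite /f scaler_sumr -big_split /=; apply: eq_bigr => i _.
  by rewrite linearP scalerDl scalerA.
have fe i : f (tnth e i) = v i.
  rewrite /f (bigD1 i) //= big1 ?addr0 => [|j ji]; rewrite (tnth_nth 0) coord_free;
    rewrite ?(basis_free e_basis) ?eqxx ?scale1r //.
  by rewrite eq_sym (negbTE ji) scale0r.
rewrite -[RHS](P0 _ (curvature_tensor_pullback f_lin A_curv)).
apply: eq_bigr => s _; congr (_ * _); apply: eq_bigr => i _; congr (_ * _).
by apply: eq_bigr => k _; rewrite !fe.
Qed.

(** For a fixed tensor and fixed vectors, the invariant on [G + x *: H] is a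
polynomial in [x], which cannot vanish on a whole interval unless it is zero. *)
Lemma invariant_vanishes_line G H : (forall x, 0 < x < 2^-1 ->
    invariant_vanishes (G + x *: H)) -> forall x, invariant_vanishes (G + x *: H).
Proof.
move=> GH0 x V v A A_curv.
pose F i := \prod_(k < 2 * l)
  ((G (i (metric_slot k 0)) (i (metric_slot k 1)))%:P +
   H (i (metric_slot k 0)) (i (metric_slot k 1)) *: 'X).
pose p : {poly R} := \sum_s c s *: \sum_(i : {ffun 'I_(4 * l) -> 'I_m})
  (\prod_(k < l)
       A (v (i (s (tensor_slot k 0)))) (v (i (s (tensor_slot k 1))))
         (v (i (s (tensor_slot k 2)))) (v (i (s (tensor_slot k 3))))) *: F i.
have pE y : p.[y] = \sum_s c s * contraction (G + y *: H) v s A.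
  rewrite /p horner_sum; apply: eq_bigr => s _; rewrite hornerZ; congr (_ * _).
  rewrite horner_sum; apply: eq_bigr => i _; rewrite hornerZ mulrC; congr (_ * _).
  by rewrite horner_prod; apply: eq_bigr => k _; rewrite !hornerE !mxE [y * _]mulrC.
rewrite -pE; suff -> : p = 0 by rewrite horner0.
(* The points 1/3, 1/4, ... all lie in the open interval (0, 1/2). *)
pose r := [seq (n.+3)%:R^-1 : R | n <- iota 0 (size p)].
apply: (@roots_geq_poly_eq0 _ p r).
- apply/allP => _ /mapP[n _ ->]; rewrite /root pE; apply/eqP/GH0 => //.
  by rewrite invr_gt0 ltr0n ltf_pV2 ?posrE ?ltr0n // ltr_nat.
- rewrite map_inj_uniq ?iota_uniq // => n n' /invr_inj /eqP.
  by rewrite eqr_nat => /eqP [].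
- by rewrite size_map size_iota.
Qed.

Definition diagonal_signs (d : 'rV[R]_m) := forall i, d 0 i = 1 \/ d 0 i = -1.

(** This is where the signature changes: for [0 < x < 1/2] the point
[(1 - x) d + x d'] has the signs of [d], hence is congruent to it. *)
Lemma invariant_vanishes_signs (d d' : 'rV[R]_m) :
  diagonal_signs d -> diagonal_signs d' ->
  invariant_vanishes (diag_mx d) -> invariant_vanishes (diag_mx d').
Proof.
move=> d1 d'1 d0.
have -> : diag_mx d' = diag_mx d + 1 *: diag_mx (d' - d).
  by rewrite scale1r -raddfD addrC subrK.
apply: invariant_vanishes_line => x /andP[x0 x2].
(* The ratio of the point to [d] at [i]: as [d 0 i] is its own inverse, it is
   either [1] or [1 - x - x]. *)
pose t := \row_i Num.sqrt (1 - x + x * (d 0 i * d' 0 i)).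
suff -> : diag_mx d + x *: diag_mx (d' - d) =
    (diag_mx t)^T *m diag_mx d *m diag_mx t.
  exact: invariant_vanishes_congruence.
rewrite tr_diag_mx !mulmx_diag -linearZ -raddfD /=; congr diag_mx.
apply/rowP => i; rewrite !mxE mulrAC -expr2 sqr_sqrtr; last first.
  have x2' : x + x <= 1.
    by rewrite -mulr2n -mulr_natr -ler_pdivlMr ?ltr0n // div1r ltW.
  case: (d1 i) (d'1 i) => -> [] ->; rewrite ?mulNr ?mulrN ?mul1r ?mulr1 ?opprK;
    rewrite ?subrK ?ler01 //; rewrite -addrA -opprD subr_ge0 //.
have dd : d 0 i * d 0 i = 1 by case: (d1 i) => ->; rewrite ?mulrNN mulr1.
rewrite mulrDl mulrBl mul1r mulrBr -[x * _ * _]mulrA mulrAC dd mul1r.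
by rewrite addrAC -!addrA addrCA.
Qed.

End Contraction.

(** * Reduction to orthonormal bases *)

Section Gram.
Variables (R : realType) (m : nat) (V : vectType R) (eps : {symmetric V}).
Implicit Types e b : m.-tuple V.

Definition change_of_basis b e : 'M[R]_m :=
  \matrix_(i, j) coord b j (tnth e i).

Lemma change_of_basisE b e i : basis_of {:V} b ->
  tnth e i = \sum_j change_of_basis b e i j *: tnth b j.
Proof.
move=> b_basis; rewrite {1}(coord_basis b_basis (memvf (tnth e i))).
by apply: eq_bigr => j _; rewrite mxE (tnth_nth 0 b).
Qed.

Lemma change_of_basisK b e : basis_of {:V} b -> basis_of {:V} e ->
  change_of_basis b e *m change_of_basis e b = 1%:M.
Proof.
move=> b_basis e_basis; apply/matrixP => i j.
rewrite [RHS]mxE -(coord_free i j (basis_free e_basis)).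
rewrite -(tnth_nth 0) (change_of_basisE e i b_basis) linear_sum mxE.
by apply: eq_bigr => k _; rewrite linearZ /= [change_of_basis e b k j]mxE.
Qed.

Lemma gram_change_of_basis b e : basis_of {:V} b ->
  gram eps e =
  change_of_basis b e *m gram eps b *m (change_of_basis b e)^T.
Proof.
move=> b_basis; apply/matrixP => i j; rewrite [LHS]mxE [RHS]mxE.
rewrite (change_of_basisE e j b_basis) linear_sumr; apply: eq_bigr => k _.
rewrite linearZr_LR /= [_^T k j]mxE mulrC; congr (_ * _).
rewrite (change_of_basisE e i b_basis) linear_sumlz mxE; apply: eq_bigr => a _.
by rewrite linearZl_LR /= [gram _ _ _ _]mxE.
Qed.

Lemma signature_basis p q : has_signature eps p q -> m = (p + q)%N ->
  exists b (d : 'rV[R]_m),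
    [/\ basis_of {:V} b, diagonal_signs d & gram eps b = diag_mx d].
Proof.
move=> [b [b_basis bE]] eq_m; rewrite -eq_m in b b_basis bE *.
exists b, (\row_i if (i < p)%N then -1 else 1); split=> // [i|].
  by rewrite mxE; case: ifP; [right | left].
apply/matrixP => i j; rewrite !mxE bE.
by case: eqP => // _; rewrite ?mulr1n ?mulr0n.
Qed.

(** With [C] the matrix of [e] in an orthonormal basis, the Gram matrix of [e] is
[C *m diag_mx d *m C^T], and a diagonal matrix of signs is its own inverse. The
congruence is needed in both directions: one to leave the first metric, the
other to reach the second. *)
Lemma invmx_gram_signs p q e : has_signature eps p q -> m = (p + q)%N ->
  basis_of {:V} e ->
  exists (d : 'rV[R]_m) (S S' : 'M[R]_m), [/\ diagonal_signs d,
    invmx (gram eps e) = S^T *m diag_mx d *m S &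
    diag_mx d = S'^T *m invmx (gram eps e) *m S'].
Proof.
move=> sgn eq_m e_basis; have [b [d [b_basis d1 gramE]]] := signature_basis sgn eq_m.
set C := change_of_basis b e; set C' := change_of_basis e b.
have CC' : C *m C' = 1%:M by rewrite change_of_basisK.
have CC't : C^T *m C'^T = 1%:M by rewrite -trmx_mul change_of_basisK ?trmx1.
have dd : diag_mx d *m diag_mx d = 1%:M.
  rewrite mulmx_diag -diag_const_mx; congr diag_mx; apply/rowP => i.
  by rewrite !mxE; case: (d1 i) => ->; rewrite ?mulrNN mulr1.
have gI : gram eps e *m (C'^T *m diag_mx d *m C') = 1%:M.
  rewrite (gram_change_of_basis e b_basis) gramE -/C !mulmxA.
  rewrite -[_ *m C^T *m C'^T]mulmxA CC't mulmx1.
  by rewrite -[_ *m diag_mx d *m diag_mx d]mulmxA dd mulmx1.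
have invE : invmx (gram eps e) = C'^T *m diag_mx d *m C'.
  by have [gU _] := mulmx1_unit gI; rewrite -[RHS](mulKmx gU) gI mulmx1.
exists d, C', C; split=> //.
have C'C : C' *m C = 1%:M by rewrite change_of_basisK.
rewrite invE !mulmxA CC't mul1mx.
by rewrite -mulmxA C'C mulmx1.
Qed.

End Gram.

(** * Independence of the signature *)

Theorem theorem1p3 (R : realType) (l : nat) (hl : (1 <= l)%N)
    (c : 'S_(4 * l) -> R) (m p1 q1 p2 q2 : nat)
    (hm1 : m = (p1 + q1)%N) (hm2 : m = (p2 + q2)%N)
    (V1 V2 : vectType R) (eps1 : {symmetric V1}) (eps2 : {symmetric V2})
    (hV1 : inner_product_space eps1 p1 q1)
    (hV2 : inner_product_space eps2 p2 q2)
    (e1 : m.-tuple V1) (e2 : m.-tuple V2)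
    (he1 : basis_of {:V1} e1) (he2 : basis_of {:V2} e2) :
  (forall A1 : V1 -> V1 -> V1 -> V1 -> R,
     curvature_tensor A1 -> Pinv eps1 e1 c A1 = 0) <->
  (forall A2 : V2 -> V2 -> V2 -> V2 -> R,
     curvature_tensor A2 -> Pinv eps2 e2 c A2 = 0).
Proof.
have [_ _ /(invmx_gram_signs)/(_ hm1 he1)] := hV1.
have [_ _ /(invmx_gram_signs)/(_ hm2 he2)] := hV2.
move=> [d2 [S2 [S2' [sgn2 inv2 diag2]]]] [d1 [S1 [S1' [sgn1 inv1 diag1]]]].
rewrite !Pinv_vanishes //; split=> P0.
  rewrite inv2; apply/invariant_vanishes_congruence.
  apply: invariant_vanishes_signs sgn1 sgn2 _.
  by rewrite diag1; apply: invariant_vanishes_congruence.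
rewrite inv1; apply/invariant_vanishes_congruence.
apply: invariant_vanishes_signs sgn2 sgn1 _.
by rewrite diag2; apply: invariant_vanishes_congruence.
Qed.
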